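(* Let $H$ be an $n\times n$ real upper Hessenberg matrix with diagonal elements $\alpha_1,\ldots,\alpha_n$, and assume the floating point assumptions stated in the context. If $$\hat{c}_1^{(i)}=\mathrm{fl}\left[\hat{c}_1^{(i-1)}-\alpha_i\right],\qquad 2\leq i\leq n,$$ then $$|e_1^{(i)}|\leq |e_1^{(i-1)}|+u\,|\hat c_1^{(i)}|, \qquad 2\leq i\leq n.$$
   Context: $H_i$ is the leading principal submatrix of $H$ of order $i$, and $\det(\lambda I-H_i)=\lambda^i+c_1^{(i)}\lambda^{i-1}+\cdots+c_{i-1}^{(i)}\lambda+c_i^{(i)}$, $1\le i\le n$. Thus $c_1^{(1)}=-\alpha_1$ and $c_1^{(i)}=c_1^{(i-1)}-\alpha_i$ for $2\le i\le n$. Floating point assumptions: all matrix elements are normalized real floating point numbers; $u$ is the unit roundoff and $nu<1$; no operation underflows or overflows; $\mathrm{fl}[\cdot]$ denotes the result computed in floating point arithmetic. For $\mathrm{op}\in\{+,-,\times,/\}$ and normalized real floating point numbers $x,y$ such that $x\ \mathrm{op}\ y$ does not underflow or overflow, $\mathrm{fl}[x\ \mathrm{op}\ y]=(x\ \mathrm{op}\ y)(1+\delta)$ for some $|\delta|\le u$, and also $\mathrm{fl}[x\ \mathrm{op}\ y]=(x\ \mathrm{op}\ y)/(1+\epsilon)$ for some $|\epsilon|\le u$. $\hat c_j^{(i)}$ denotes the floating point computed value of $c_j^{(i)}$, with error $e_j^{(i)}=\hat c_j^{(i)}-c_j^{(i)}$. The starting value is exact: $\hat c_1^{(1)}=c_1^{(1)}=-\alpha_1$,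 so $e_1^{(1)}=0$. *)

(* Defs.v *)
From HB Require Import structures.
From mathcomp Require Import all_boot all_order all_algebra.
From mathcomp Require Import reals.

Set Implicit Arguments.
Unset Strict Implicit.
Unset Printing Implicit Defensive.

Import Order.TTheory GRing.Theory Num.Theory.

Local Open Scope ring_scope.

Record fp_format := FpFormat {
  radix : nat;
  prec : nat;
  emin : int;
  emax : int;
  radix_gt1 : (1 < radix)%N;
  prec_gt0 : (0 < prec)%N;
  emin_le_emax : emin <= emax
}.

(* The significand is an integer with exactly [prec] digits in base [radix].
   Zero has no such representation but is a machine number, and a Hessenberg
   matrix has zero entries, so it is admitted separately. *)
Definition normalized (R : realType) (F : fp_format) (x : R) : Prop :=
  x = 0 \/
  exists (s : bool) (m : nat) (e : int),
    [/\ (radix F ^ (prec F).-1 <= m < radix F ^ prec F)%N,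
        emin F <= e <= emax F
      & x = (-1) ^+ s * m%:R * (radix F)%:R ^ e].

Inductive fp_op := FpAdd | FpSub | FpMul | FpDiv.

Definition exact_op (R : realType) (o : fp_op) (x y : R) : R :=
  match o with
  | FpAdd => x + y
  | FpSub => x - y
  | FpMul => x * y
  | FpDiv => x / y
  end.

(* Floating point arithmetic on the format [F] with unit roundoff [u].
   [in_range o x y] says that the operation [o] on [x] and [y] neither
   underflows nor overflows.  It is a parameter because conventions differ
   (range test before or after rounding, gradual underflow or not).  Outside
   it, or on operands that are not machine numbers, [fl] is unconstrained.
   The rounding mode is constrained only by the two error models. *)
Record fp_arith (R : realType) (F : fp_format) := FpArith {
  u : R;
  fl : fp_op -> R -> R -> R;
  in_range : fp_op -> R -> R -> Prop;
  u_gt0 : 0 < u;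
  fl_normalized : forall o x y,
    normalized F x -> normalized F y -> (o = FpDiv -> y != 0) ->
    in_range o x y -> normalized F (fl o x y);
  fl_mul_model : forall o x y,
    normalized F x -> normalized F y -> (o = FpDiv -> y != 0) ->
    in_range o x y ->
    exists2 delta : R, `|delta| <= u & fl o x y = exact_op o x y * (1 + delta);
  fl_div_model : forall o x y,
    normalized F x -> normalized F y -> (o = FpDiv -> y != 0) ->
    in_range o x y ->
    exists2 eps : R, `|eps| <= u & fl o x y = exact_op o x y / (1 + eps)
}.

Definition upper_hessenberg (R : realType) (n : nat) (H : 'M[R]_n) : Prop :=
  forall j k : 'I_n, (k.+1 < j)%N -> H j k = 0.

(* Matrix orders and the indices [i], [j] below are 1-based as in the usual
   notation, while ['I_n.+1] is 0-based; [inord] makes the definitions total,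
   and they are meaningful for [1 <= i <= n.+1] and [j <= i]. *)
Definition alpha (R : realType) (n : nat) (H : 'M[R]_n.+1) (i : nat) : R :=
  H (inord i.-1) (inord i.-1).

Definition leading_sub (R : realType) (n : nat) (H : 'M[R]_n.+1) (i : nat) :
    'M[R]_i :=
  \matrix_(j < i, k < i) H (inord j) (inord k).

(* [char_poly A] is the determinant of ['X%:M - A], so this is the coefficient
   of ['X^(i - j)] in the characteristic polynomial of the leading block. *)
Definition charcoef (R : realType) (n : nat) (H : 'M[R]_n.+1) (j i : nat) : R :=
  (char_poly (leading_sub H i))`_(i - j).

Definition coef_err (R : realType) (n : nat) (H : 'M[R]_n.+1)
    (chat : nat -> nat -> R) (j i : nat) : R :=
  chat j i - charcoef H j i.

(* Main.v *)
Require Import Defs.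
From HB Require Import structures.
From mathcomp Require Import all_boot all_order all_algebra.
From mathcomp Require Import reals ring lra.

Set Implicit Arguments.
Unset Strict Implicit.
Unset Printing Implicit Defensive.

Import Order.TTheory GRing.Theory Num.Theory.

Local Open Scope ring_scope.

(** The coefficient of index 1 is minus the trace of the leading block, so it obeys exactly the
    recurrence that the algorithm runs in floating point ([charcoef1_rec]). Subtracting the two
    recurrences, the new error is the old one plus the rounding error of a single subtraction. The
    division model writes the exact difference as the computed one times [1 + eps], so this rounding
    error is [- eps] times the computed value ([fl_abs_error]); hence the bound involves the
    computed coefficient, with constant exactly [u]. *)

(** The sign is stored apart from significand and exponent. This is what makes the starting value
    [- alpha H 1] a machine number. *)
Lemma normalizedN (R : realType) (F : fp_format) (x : R) :
  normalized F x -> normalized F (- x).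
Proof.
case=> [->|[s [m [e [m_bnd e_bnd ->]]]]]; first by left; rewrite oppr0.
by right; exists (~~ s), m, e; split; rewrite // signrN !mulNr.
Qed.

(** The subleading coefficient of a characteristic polynomial is minus the trace. For [i = 0] the
    index [i - 1] truncates to 0 and picks the leading coefficient 1 instead. *)
Lemma charcoef1 (R : realType) (n : nat) (H : 'M[R]_n.+1) (i : nat) :
  (0 < i)%N -> charcoef H 1 i = - \sum_(1 <= k < i.+1) alpha H k.
Proof.
move=> i_gt0; rewrite /charcoef subn1 char_poly_trace //; congr (- _).
by rewrite big_add1 big_mkord; apply: eq_bigr => k _; rewrite mxE.
Qed.

Lemma charcoef1_rec (R : realType) (n : nat) (H : 'M[R]_n.+1) (i : nat) :
  (1 < i)%N -> charcoef H 1 i = charcoef H 1 i.-1 - alpha H i.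
Proof.
case: i => [|[|i]] // _.
by rewrite !charcoef1 // big_nat_recr //= opprD.
Qed.

(* The hypothesis [u A < 1] excludes [eps = -1], where [x / 0 = 0] would void
   the division model. *)
Lemma fl_abs_error (R : realType) (F : fp_format) (A : fp_arith R F)
    (o : fp_op) (x y : R) :
  u A < 1 -> normalized F x -> normalized F y -> (o = FpDiv -> y != 0) ->
  in_range A o x y ->
  `|fl A o x y - exact_op o x y| <= u A * `|fl A o x y|.
Proof.
move=> u_lt1 Fx Fy y_neq0 xy_ok.
have [eps eps_le ->] := fl_div_model Fx Fy y_neq0 xy_ok.
have eps1_neq0 : 1 + eps != 0.
  by have := le_lt_trans eps_le u_lt1; rewrite ltr_norml => /andP[? _]; lra.
set z := exact_op o x y.
have -> : z / (1 + eps) - z = - (eps * (z / (1 + eps))) by field.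
by rewrite normrN normrM ler_wpM2r.
Qed.

Theorem theorem5p1 (R : realType) (F : fp_format) (A : fp_arith R F)
    (n : nat) (H : 'M[R]_n.+1) (chat : nat -> nat -> R)
    (H_hess : upper_hessenberg H)
    (H_float : forall j k, normalized F (H j k))
    (nu_lt1 : n.+1%:R * u A < 1)
    (chat_init : chat 1%N 1%N = - alpha H 1)
    (chat_rec : forall i : nat, (2 <= i <= n.+1)%N ->
       chat 1%N i = fl A FpSub (chat 1%N i.-1) (alpha H i))
    (no_exception : forall i : nat, (2 <= i <= n.+1)%N ->
       in_range A FpSub (chat 1%N i.-1) (alpha H i)) :
  forall i : nat, (2 <= i <= n.+1)%N ->
    `|coef_err H chat 1 i| <= `|coef_err H chat 1 i.-1| + u A * `|chat 1%N i|.
Proof.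
(* The error models constrain [fl] on machine numbers only, so every computed coefficient must first
   be shown to be one. *)
have chat_float i : (0 < i <= n.+1)%N -> normalized F (chat 1%N i).
  elim: i => [|[|i] IHi] //= i_le.
    by rewrite chat_init; apply: normalizedN; apply: H_float.
  rewrite chat_rec //; apply: fl_normalized => //; [|exact: H_float|exact: no_exception].
  by apply: IHi; apply: ltnW.
move=> i i_bnd; have /andP[i_gt1 i_le] := i_bnd.
have u_lt1 : u A < 1.
  apply: le_lt_trans nu_lt1; rewrite ler_peMl ?ler1n //.
  by apply: ltW; apply: u_gt0.
have chat_float' : normalized F (chat 1%N i.-1).
  by apply: chat_float; case: (i) i_gt1 i_le => [|[|k]] //= _ /ltnW.
have fpSub_div : FpSub = FpDiv -> alpha H i != 0 by [].
have := fl_abs_error u_lt1 chat_float' (H_float _ _) fpSub_div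
  (no_exception i i_bnd).
rewrite -chat_rec //= => fl_err.
rewrite /coef_err charcoef1_rec //.
set a := alpha H i in fl_err *; set c := charcoef H 1 i.-1.
(* Inherited error plus local rounding error. *)
have -> : chat 1%N i - (c - a) =
    (chat 1%N i.-1 - c) + (chat 1%N i - (chat 1%N i.-1 - a)) by ring.
by apply: le_trans (ler_normD _ _) _; rewrite lerD2l.
Qed.
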